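(* Let $X\in\mathfrak{PO}_{fd}$. Then $X$ does not contain any isomorphic copy of $C(K_{\mathcal{A}})$, where $\mathcal{A}$ is an almost disjoint family of infinite subsets of $\mathbb{N}$ with $|\mathcal{A}|=\aleph_1$.
   Context: All Banach spaces are real; isometric embeddings are always linear. A family $\mathcal{A}$ of infinite subsets of $\mathbb{N}$ is almost disjoint if $A\cap B$ is finite for all $A\neq B$ in $\mathcal{A}$. $K_{\mathcal{A}}$ is the one-point compactification of the locally compact space $\mathbb{N}\cup\mathcal{A}$ whose topology has as a base all singletons of $\mathbb{N}$ and all sets $\{A\}\cup(A\setminus F)$ with $A\in\mathcal{A}$ and $F\subseteq\mathbb{N}$ finite. $C(K_{\mathcal{A}})$ has the supremum norm. Pushout: given Banach spaces $Z\subseteq F$ and an isometric embedding $j\colon Z\to Y$, the pushout space is $W=(F\oplus_1 Y)/\Delta$, where $F\oplus_1 Y$ carries the $\ell_1$-sum norm and $\Delta=\{(z,-j(z)) : z\in Z\}$, with the canonical maps $F\to W$, $x\mapsto(x,0)+\Delta$, and $Y\to W$, $y\mapsto(0,y)+\Delta$ (both are isometric embeddings); $Y$ is identified with its image in $W$. The class $\mathfrak{PO}_{fd}$ consists of all Banach spaces that can be obtained as the limit (i.e. the completion of the union) of a transfinite chain of Banach spaces $\{X_\alpha\}_{\alpha<\rho}$ such that $X_0$ is separable, $X_\delta=\operatorname{cl}(\bigcup_{\xi<\delta}X_\xi)$ for every limit ordinal $\delta<\rho$, and for each $\alpha$ with $\alpha+1<\rho$ the inclusion $X_\alpha\subseteq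 X_{\alpha+1}$ is (up to linear isometry) the canonical map of $X_\alpha$ into the pushout space of an inclusion $E_\alpha\subseteq F_\alpha$ of finite-dimensional Banach spaces and an isometric embedding $j_\alpha\colon E_\alpha\to X_\alpha$. *)

(* Defs.v *)
From HB Require Import structures.
From mathcomp Require Import all_boot all_order all_algebra.
From mathcomp Require Import generic_quotient ring_quotient.
From mathcomp Require Import all_classical all_reals all_analysis.

Set Implicit Arguments.
Unset Strict Implicit.
Unset Printing Implicit Defensive.

Import Order.TTheory GRing.Theory Num.Def Num.Theory.
Import numFieldNormedType.Exports.

Local Open Scope classical_set_scope.
Local Open Scope card_scope.
Local Open Scope ring_scope.

Record linear_isometry (R : realType) (V W : normedModType R) := LinearIsometry {
  lisom :> {linear V -> W};
  lisomP : forall x : V, `|lisom x| = `|x|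
}.

Definition contains_isomorphic_copy (R : realType) (X Y : normedModType R) : Prop :=
  exists (T : {linear Y -> X}) (c C : R),
    0 < c /\ forall y : Y, c * `|y| <= `|T y| <= C * `|y|.

Definition finite_dimensional (R : realType) (V : normedModType R) : Prop :=
  exists (n : nat) (v : 'I_n -> V),
    forall x : V, exists c : 'I_n -> R, x = \sum_(i < n) c i *: v i.

Definition separable (T : topologicalType) : Prop :=
  exists D : set T, countable D /\ dense D.

HB.mixin Record isCompactSpace (T : Type) & Topological T := {
  compact_setT : compact [set: T]
}.

#[short(type="compactTopologicalType")]
HB.structure Definition CompactTopological := {T of isCompactSpace T & Topological T}.

HB.instance Definition _ (T : topologicalType) :=
  isCompactSpace.Build (one_point_compactification T)
    one_point_compactification_compact.

Section continuous_functions.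
Context (K : compactTopologicalType) (R : realType).

Definition continuous_pred : {pred K -> R^o} := mem [set f : K -> R^o | continuous f].

Lemma continuous_pred_submod : submod_closed continuous_pred.
Proof.
split=> [|a f g]; rewrite !inE /=; first by move=> x; exact: cvg_cst.
by move=> cf cg x; apply: cvgD; [apply: cvgZr; exact: cf|exact: cg].
Qed.

HB.instance Definition _ := GRing.isSubmodClosed.Build R (K -> R^o) continuous_pred
  continuous_pred_submod.

Record cfun := CFun {
  cfun_fun :> K -> R^o;
  _ : cfun_fun \in continuous_pred
}.

HB.instance Definition _ := [isSub for cfun_fun].
HB.instance Definition _ := [Choice of cfun by <:].
HB.instance Definition _ := [SubChoice_isSubLmodule of cfun by <:].

Lemma cfun_continuous (f : cfun) : continuous f.
Proof. by have := valP f; rewrite inE. Qed.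

Definition sup_norm (f : cfun) : R := sup (range (fun x => `|f x|)).

Lemma cfun_has_ubound (f : cfun) : has_ubound (range (fun x => `|f x|)).
Proof.
have cf : compact (range f).
  apply: continuous_compact; last exact: compact_setT.
  by apply: continuous_subspaceT; exact: cfun_continuous.
have [M [_ HM]] := compact_bounded cf.
exists (M + 1) => _ [x _ <-]; apply: (HM (M + 1)); first by rewrite ltrDl.
by exists x.
Qed.

Lemma le_sup_norm (f : cfun) x : `|f x| <= sup_norm f.
Proof. by apply: ub_le_sup; [exact: cfun_has_ubound|exists x]. Qed.

Lemma sup_norm_ge0 (f : cfun) : 0 <= sup_norm f.
Proof.
have [[x _]|/nonemptyPn K0] := pselect ([set: K] !=set0).
  exact: le_trans (le_sup_norm f x).
by rewrite /sup_norm K0 image_set0 sup0.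
Qed.

Lemma sup_norm_le (f : cfun) (M : R) :
  0 <= M -> (forall x, `|f x| <= M) -> sup_norm f <= M.
Proof.
move=> M0 fM; have [[x _]|/nonemptyPn K0] := pselect ([set: K] !=set0).
  by apply: ge_sup; [exists `|f x|; exists x|move=> _ [y _ <-]].
by rewrite /sup_norm K0 image_set0 sup0.
Qed.

Lemma sup_norm_triangle (f g : cfun) : sup_norm (f + g) <= sup_norm f + sup_norm g.
Proof.
apply: sup_norm_le => [|x]; first by rewrite addr_ge0 ?sup_norm_ge0.
by rewrite (le_trans (ler_normD _ _))// lerD ?le_sup_norm.
Qed.

Lemma sup_normZ (a : R) (f : cfun) : sup_norm (a *: f) = `|a| * sup_norm f.
Proof.
have le_Z b (h : cfun) : sup_norm (b *: h) <= `|b| * sup_norm h.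
  apply: sup_norm_le => [|x]; first by rewrite mulr_ge0 ?sup_norm_ge0.
  by rewrite [(b *: h) x]/= normrM ler_wpM2l ?le_sup_norm.
apply/eqP; rewrite eq_le le_Z /=.
have [->|a0] := eqVneq a 0; first by rewrite normr0 mul0r sup_norm_ge0.
rewrite -ler_pdivlMl ?normr_gt0// -normfV.
by rewrite -{1}[f](scalerK a0) le_Z.
Qed.

Lemma sup_norm0_eq0 (f : cfun) : sup_norm f = 0 -> f = 0.
Proof.
move=> f0; apply: val_inj; apply/funext => x /=.
by apply/eqP; rewrite -normr_le0 -f0 le_sup_norm.
Qed.

HB.instance Definition _ := Lmodule_isNormed.Build R cfun
  sup_norm_triangle sup_normZ sup_norm0_eq0.

Lemma cfun_normE (f : cfun) : `|f| = sup (range (fun x => `|f x|)).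
Proof. by []. Qed.

End continuous_functions.

Definition almost_disjoint_family (A : set (set nat)) : Prop :=
  (forall B, A B -> infinite_set B) /\
  (forall B C, A B -> A C -> B <> C -> finite_set (B `&` C)).

Definition psi_space (A : set (set nat)) : Type := (nat + A)%type.

Section psi_space.
Context (A : set (set nat)).

HB.instance Definition _ := Choice.on (psi_space A).

(* Points of nat are [inl n], elements of the family are [inr a]. *)
Definition psi_base : set (set (psi_space A)) :=
  [set U | (exists n : nat, U = [set inl n]) \/
           (exists (a : A) (F : set nat), finite_set F /\
              U = [set inr a] `|` (inl @` (set_val a `\` F)))].

Lemma psi_base_cover : \bigcup_(U in psi_base) U = setT.
Proof.
apply/seteqP; split=> // -[n|a] _.
  by exists [set inl n] => //; left; exists n.
exists ([set inr a] `|` (inl @` (set_val a `\` set0))); last by left.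
by right; exists a, set0; split; first exact: finite_set0.
Qed.

Lemma psi_base_join (U V : set (psi_space A)) t : psi_base U -> psi_base V ->
  U t -> V t -> exists W, [/\ psi_base W, W t & W `<=` U `&` V].
Proof.
case: t => [n|a] bU bV Ut Vt.
  by exists [set inl n]; split; [left; exists n|by []|move=> _ ->].
have canon W : psi_base W -> W (inr a) -> exists F, finite_set F /\
    W = [set inr a] `|` (inl @` (set_val a `\` F)).
  case=> [[n ->] //|[b [F [fF ->]]] [[ba]|[? ? //]]].
  by exists F; rewrite ba.
have [F [fF EU]] := canon _ bU Ut; have [G [fG EV]] := canon _ bV Vt.
exists ([set inr a] `|` (inl @` (set_val a `\` (F `|` G)))); split.
- by right; exists a, (F `|` G); split => //; rewrite finite_setU.
- by left.
- rewrite EU EV => _ [->|[n [an /not_orP[nF nG]] <-]]; first by split; left.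
  by split; right; exists n.
Qed.

HB.instance Definition _ :=
  isBaseTopological.Build (psi_space A) psi_base_cover psi_base_join.

End psi_space.

(* The library's compactification always adds a point; it is isolated only if
   [psi_space A] is already compact, which forces [A] to be finite. *)
Definition K_A (A : set (set nat)) : compactTopologicalType :=
  one_point_compactification (psi_space A).

(* aleph_1 as the least uncountable cardinal. *)
Definition card_eq_aleph1 (T : Type) (A : set T) : Prop :=
  ~ countable A /\
  forall (U : Type) (B : set U), ~ countable B -> A #<= B.

Record closed_subspace (R : realType) (V : normedModType R) := ClosedSubspace {
  subspace_set :> set V;
  _ : submod_closed (mem subspace_set);
  subspace_closed : closed subspace_set
}.

Definition subspace_pred (R : realType) (V : normedModType R) (S : closed_subspace V) :
  {pred V} := mem (subspace_set S).

Fact subspace_pred_submod (R : realType) (V : normedModType R) (S : closed_subspace V) :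
  submod_closed (subspace_pred S).
Proof. by case: S. Qed.

HB.instance Definition _ (R : realType) (V : normedModType R) (S : closed_subspace V) :=
  GRing.isSubmodClosed.Build R V (subspace_pred S) (subspace_pred_submod S).

Section normed_quotient.
Context (R : realType) (V : normedModType R) (S : closed_subspace V).
Local Open Scope quotient_scope.

Definition normed_quotient : Type := Quotient.quot (subspace_pred S).
HB.instance Definition _ := GRing.Zmodule.on normed_quotient.

Definition quotient_proj (v : V) : normed_quotient := \pi_(Quotient.quot (subspace_pred S)) v.

Lemma quotient_projP (q : normed_quotient) : exists v, quotient_proj v = q.
Proof. by exists (repr (q : Quotient.quot (subspace_pred S))); exact: reprK. Qed.

Lemma quotient_proj_eq u v : (quotient_proj u = quotient_proj v) <-> u - v \in subspace_pred S.
Proof.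
split=> [uv|uv]; first by rewrite Quotient.idealrBE; apply/eqP.
by apply/eqP; rewrite -Quotient.idealrBE.
Qed.

Lemma quotient_projD u v : quotient_proj (u + v) = quotient_proj u + quotient_proj v.
Proof. exact: raddfD. Qed.

Definition quotient_scale (a : R) (q : normed_quotient) : normed_quotient :=
  quotient_proj (a *: repr (q : Quotient.quot (subspace_pred S))).

Lemma quotient_projZ a v : quotient_proj (a *: v) = quotient_scale a (quotient_proj v).
Proof.
apply/quotient_proj_eq; rewrite -scalerBr rpredZ//.
by apply/quotient_proj_eq; rewrite /quotient_proj reprK.
Qed.

Fact quotient_scaleA a b q :
  quotient_scale a (quotient_scale b q) = quotient_scale (a * b) q.
Proof. by have [v <-] := quotient_projP q; rewrite -!quotient_projZ scalerA. Qed.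
Fact quotient_scale1 : left_id 1 quotient_scale.
Proof. by move=> q; have [v <-] := quotient_projP q; rewrite -quotient_projZ scale1r. Qed.
Fact quotient_scaleDr : right_distributive quotient_scale +%R.
Proof.
move=> a p q; have [u <-] := quotient_projP p; have [v <-] := quotient_projP q.
by rewrite -!(quotient_projZ, quotient_projD) scalerDr.
Qed.
Fact quotient_scaleDl q : {morph quotient_scale^~ q : a b / a + b}.
Proof.
by move=> a b; have [v <-] := quotient_projP q;
  rewrite -!(quotient_projZ, quotient_projD) scalerDl.
Qed.

HB.instance Definition _ := GRing.Zmodule_isLmodule.Build R normed_quotient
  quotient_scaleA quotient_scale1 quotient_scaleDr quotient_scaleDl.

Fact quotient_proj_linear : linear quotient_proj.
Proof. by move=> a u v; rewrite quotient_projD quotient_projZ. Qed.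

HB.instance Definition _ :=
  GRing.isLinear.Build R V normed_quotient _ quotient_proj quotient_proj_linear.

Definition quotient_norm (q : normed_quotient) : R :=
  inf [set `|v| | v in [set v | quotient_proj v = q]].

Lemma quotient_norm_has_inf q :
  has_inf [set `|v| | v in [set v | quotient_proj v = q]].
Proof.
split; last by exists 0 => _ [v _ <-].
by have [v vq] := quotient_projP q; exists `|v|, v.
Qed.

Lemma quotient_norm_le v : quotient_norm (quotient_proj v) <= `|v|.
Proof. by apply: ge_inf; [case: (quotient_norm_has_inf (quotient_proj v))|exists v]. Qed.

Lemma quotient_norm_ge0 q : 0 <= quotient_norm q.
Proof.
apply: lb_le_inf; first by case: (quotient_norm_has_inf q).
by move=> _ [v _ <-].
Qed.

Lemma quotient_norm_adherent q (e : R) : 0 < e ->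
  exists2 v, quotient_proj v = q & `|v| < quotient_norm q + e.
Proof.
move=> e0; have [_ [v vq <-] ve] := inf_adherent e0 (quotient_norm_has_inf q).
by exists v.
Qed.

Lemma quotient_norm_triangle p q :
  quotient_norm (p + q) <= quotient_norm p + quotient_norm q.
Proof.
apply/ler_addgt0Pr => e e0; have e20 : 0 < e / 2 by rewrite divr_gt0.
have [u up ue] := quotient_norm_adherent p e20.
have [v vq ve] := quotient_norm_adherent q e20.
rewrite -{1}up -{1}vq -quotient_projD (le_trans (quotient_norm_le _))//.
rewrite (le_trans (ler_normD _ _))// [e]splitr addrACA lerD// ltW//.
Qed.

Lemma quotient_normZ a q : quotient_norm (a *: q) = `|a| * quotient_norm q.
Proof.
have le_Z b p : quotient_norm (b *: p) <= `|b| * quotient_norm p.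
  apply/ler_addgt0Pr => e e0.
  have b0 : 0 < `|b| + 1 by rewrite ltr_wpDl.
  have e'0 : 0 < e / (`|b| + 1) by rewrite divr_gt0.
  have [v vp ve] := quotient_norm_adherent p e'0.
  rewrite -{1}vp -linearZ (le_trans (quotient_norm_le _))// normrZ.
  rewrite (le_trans (ler_wpM2l _ (ltW ve)))// mulrDr lerD2l.
  by rewrite mulrCA ler_piMr ?ltW// ltr_pdivrMr// mul1r ltrDl.
apply/eqP; rewrite eq_le le_Z /=.
have [->|a0] := eqVneq a 0; first by rewrite normr0 mul0r quotient_norm_ge0.
rewrite -ler_pdivlMl ?normr_gt0// -normfV.
by rewrite -{1}[q](scalerK a0) le_Z.
Qed.

Lemma quotient_norm0_eq0 q : quotient_norm q = 0 -> q = 0.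
Proof.
have [v <-] := quotient_projP q => v0.
rewrite -(raddf0 quotient_proj); apply/quotient_proj_eq; rewrite subr0.
apply/mem_set/subspace_closed => B /nbhs_ballP[e /= e0 eB].
have [w wv] := quotient_norm_adherent (quotient_proj v) e0.
rewrite v0 add0r => we; exists (v - w); split.
  by apply/set_mem/quotient_proj_eq.
by apply: eB; rewrite -ball_normE /ball_ /= opprB addrC subrK.
Qed.

HB.instance Definition _ := Lmodule_isNormed.Build R normed_quotient
  quotient_norm_triangle quotient_normZ quotient_norm0_eq0.

Lemma quotient_normE (q : normed_quotient) :
  `|q| = inf [set `|v| | v in [set v | quotient_proj v = q]].
Proof. by []. Qed.

End normed_quotient.

(* An alias, because the library norm on [F * Y] is the maximum norm. *)
Definition l1_sum (R : realType) (F Y : normedModType R) : Type := (F * Y)%type.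

Section l1_sum.
Context (R : realType) (F Y : normedModType R).

HB.instance Definition _ := GRing.Lmodule.copy (l1_sum F Y) (F * Y)%type.

Definition l1_norm (p : l1_sum F Y) : R := `|p.1| + `|p.2|.

Fact l1_norm_triangle p q : l1_norm (p + q) <= l1_norm p + l1_norm q.
Proof. by rewrite /l1_norm addrACA lerD ?ler_normD. Qed.
Fact l1_normZ a p : l1_norm (a *: p) = `|a| * l1_norm p.
Proof. by rewrite /l1_norm !normrZ mulrDr. Qed.
Fact l1_norm0_eq0 p : l1_norm p = 0 -> p = 0.
Proof.
case: p => x y /eqP; rewrite paddr_eq0// => /andP[/eqP/normr0_eq0 /= -> /eqP/normr0_eq0 /= ->].
by [].
Qed.

HB.instance Definition _ := Lmodule_isNormed.Build R (l1_sum F Y)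
  l1_norm_triangle l1_normZ l1_norm0_eq0.

Lemma l1_normE (p : l1_sum F Y) : `|p| = `|p.1| + `|p.2|.
Proof. by []. Qed.

End l1_sum.

Lemma closed_range_bounded_below (R : realType) (Z : completeNormedModType R)
    (V : normedModType R) (f : {linear Z -> V}) (C : R) :
  (forall z, `|z| <= `|f z| <= C * `|z|) -> closed (range f).
Proof.
move=> fC p clp.
have ex n : exists z, `|p - f z| < n.+1%:R^-1.
  have n0 : 0 < n.+1%:R^-1 :> R by rewrite invr_gt0.
  have [_ [[z _ <-]]] := clp _ (nbhsx_ballx p _ n0).
  by rewrite -ball_normE; exists z.
have {ex}[z zp] := choice ex.
have small (e : R) : 0 < e -> \forall n \near \oo, `|p - f (z n)| < e.
  move=> e0; near=> n; rewrite (lt_trans (zp n))//.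
  by near: n; exact: (near_infty_natSinv_lt (PosNum e0)).
have cz : cauchy (z @ \oo).
  apply: cauchy_exP => e e0; have e20 : 0 < e / 2 by rewrite divr_gt0.
  have [N _ HN] := small _ e20; exists (z N); exists N => // n /= Nn.
  rewrite -ball_normE /ball_ /=; have /andP[+ _] := fC (z N - z n).
  move=> /le_lt_trans; apply; rewrite linearB [e]splitr.
  rewrite (le_lt_trans (ler_distD p _ _))// ltrD//; last exact: HN.
  by rewrite distrC HN //=.
have /cvg_ex[l zl] : cvg (z @ \oo) by exact: cauchy_cvg.
exists l => //; apply/eqP; rewrite eq_sym -subr_eq0 -normr_le0.
apply/ler_addgt0Pr => e e0; rewrite add0r.
have e20 : 0 < e / 2 by rewrite divr_gt0.
have C0 : 0 < `|C| + 1 by rewrite ltr_wpDl.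
have e'0 : 0 < e / 2 / (`|C| + 1) by rewrite divr_gt0.
near \oo => n; rewrite (le_trans (ler_distD (f (z n)) _ _))// [e]splitr.
rewrite lerD//; first by apply: ltW; near: n; exact: small.
rewrite -linearB; have /andP[_ /le_trans] := fC (z n - l); apply.
have zn : `|z n - l| <= e / 2 / (`|C| + 1).
  by rewrite distrC; apply: ltW; near: n; move/cvgrPdist_lt: zl; apply.
rewrite (@le_trans _ _ ((`|C| + 1) * `|z n - l|))//.
  by rewrite ler_wpM2r// (le_trans (ler_norm C))// lerDl.
by rewrite -ler_pdivlMl// mulrC.
Unshelve. all: by end_near. Qed.

Section pushout.
Context (R : realType) (Z F Y : completeNormedModType R).
Context (i : linear_isometry Z F) (j : linear_isometry Z Y).

Definition pushout_relation (z : Z) : l1_sum F Y := (i z, - j z).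

Fact pushout_relation_linear : linear pushout_relation.
Proof.
move=> a u v; rewrite /pushout_relation (linearP (lisom i)) (linearP (lisom j)).
by rewrite opprD -scalerN.
Qed.

HB.instance Definition _ :=
  GRing.isLinear.Build R Z (l1_sum F Y) _ pushout_relation pushout_relation_linear.

Fact pushout_delta_submod : submod_closed (mem (range pushout_relation)).
Proof.
split=> [|a _ _ /set_mem[u _ <-] /set_mem[v _ <-]]; apply/mem_set.
  by exists 0; rewrite // linear0.
by exists (a *: u + v); rewrite // linearP.
Qed.

Fact pushout_delta_closed : closed (range pushout_relation).
Proof.
apply: (@closed_range_bounded_below _ _ _ _ 2) => z.
rewrite l1_normE /= normrN !lisomP.
by rewrite lerDl normr_ge0 mulr_natl mulr2n lexx.
Qed.

Definition pushout_delta : closed_subspace (l1_sum F Y) :=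
  ClosedSubspace pushout_delta_submod pushout_delta_closed.

Definition pushout : normedModType R := normed_quotient pushout_delta.

Definition pushout_inl (x : F) : pushout := quotient_proj pushout_delta (x, 0).

Definition pushout_inr (y : Y) : pushout := quotient_proj pushout_delta (0, y).

End pushout.

(* [T] identifies the pushout isometrically with [X2]; [e1] and [e2] place
   [X1] and [X2] in a common space. *)
Definition fd_pushout_step (R : realType) (X X1 X2 : completeNormedModType R)
    (e1 : linear_isometry X1 X) (e2 : linear_isometry X2 X) : Prop :=
  exists (E F : completeNormedModType R)
         (i : linear_isometry E F) (j : linear_isometry E X1)
         (T : linear_isometry (pushout i j) X2),
    [/\ finite_dimensional E, finite_dimensional F, range T = setT &
        forall y : X1, e2 (T (pushout_inr i j y)) = e1 y].

Section well_order.
Context (d : Order.disp_t) (I : orderType d).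

Definition well_ordered : Prop :=
  forall S : set I, S !=set0 -> exists m, S m /\ forall s, S s -> (m <= s)%O.

Definition is_least (a : I) : Prop := forall b, (a <= b)%O.

Definition is_succ (a b : I) : Prop :=
  (a < b)%O /\ forall c, (a < c)%O -> (b <= c)%O.

Definition is_limit (l : I) : Prop :=
  ~ is_least l /\ forall a, ~ is_succ a l.

End well_order.

(* The ordinal rho is a well-ordered type [I]; the spaces of the chain are
   Banach spaces [X_ a] with isometric embeddings [e a] into the limit [X], an
   inclusion being an inclusion of ranges. *)
Definition PO_fd (R : realType) (X : completeNormedModType R) : Prop :=
  exists (d : Order.disp_t) (I : orderType d)
         (X_ : I -> completeNormedModType R)
         (e : forall a : I, linear_isometry (X_ a) X),
    well_ordered I /\
    (forall a b : I, (a <= b)%O -> range (e a) `<=` range (e b)) /\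
    (exists a0 : I, is_least a0 /\ separable (X_ a0)) /\
    (forall l : I, is_limit l ->
       range (e l) = closure (\bigcup_(a in [set a | (a < l)%O]) range (e a))) /\
    (forall a b : I, is_succ a b -> fd_pushout_step (e a) (e b)) /\
    closure (\bigcup_a range (e a)) = [set: X].

(* Main.v *)
Require Import Defs.
From mathcomp Require Import all_boot all_order all_algebra.
From mathcomp Require Import all_classical all_reals all_analysis.
From mathcomp Require Import ring lra.

(** Why the theorem holds.  Write 1_A for the function on K_A that is 1 on
    [A] and on the point A, and 0 elsewhere.  If A_1, ..., A_n are distinct
    members of the family, almost disjointness makes 1_{A_1} + ... + 1_{A_n}
    at most 1 outside a finite set of integers, so this sum is within distance
    1 of the finitely supported functions, however large n is.  In a space X
    of the class the opposite happens: given an uncountable, uniformly separated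
    family (x_i) of vectors of norm at most K and any separable subspace, there
    are x_{i_1}, ..., x_{i_n} such that each point of the subspace within
    distance K of their sum is at distance at least n * dlt from it, where
    dlt > 0 does not depend on n ([spread_sums]).  With x_A the image of 1_A and a
    separable subspace containing the images of the finitely supported
    functions, the two estimates contradict each other for large n.

    The spreading of sums comes from the norm of a pushout: for u in X_a and f
    in F_a, the distance from u to f is the infimum over e in the
    finite-dimensional space E_a of |u - e| + |e - f|, so that every path from
    u to f may be routed through E_a.  Call a set S of indices coherent if, for
    each c in S, the space E_c lies in the closed span of X_0 and of the blocks
    F_b with b in S and b < c; let W(S) be the closed span of X_0 and of all
    F_c with c in S.  Three facts hold.
    - Every vector lies in W(S) for some countable coherent S
      ([all_supported]), and then W(S) is separable ([hull_separable]).
    - A path from X_a to W(S) may be routed through the part of W(S) built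
      before a ([stage_hull_indep]).
    - For each x in X, a path from x to a bounded part of W(S) may be routed,
      up to eps, through a finite subset of W(S)
      ([coherent_finitely_based]).

    The last fact is a reflection principle.  If S is the union of an
    increasing sequence of sets S_k, the finite subset of W(S) can be moved
    into W(S_k) for one k, and therefore each z in a ball of W(S) admits w in
    W(S_k) with |x - z| >= dlt + |z - w|, as soon as dist(x, W(S)) > dlt.
    Closing off under potential failures shows that some countable coherent S
    has the following property: for every countable coherent S' containing S,
    some member x_i of the family satisfies this for all z in a ball of W(S'),
    with w in W(S) ([reflecting_support]).  Choosing x_{i_1}, x_{i_2}, ... in
    turn, each one with respect to an S' that supports the previous ones, adds
    dlt to the distance from W(S) at each step. *)

Set Implicit Arguments.
Unset Strict Implicit.
Unset Printing Implicit Defensive.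

Import Order.TTheory GRing.Theory Num.Theory.
Import numFieldNormedType.Exports.

Local Open Scope classical_set_scope.
Local Open Scope card_scope.
Local Open Scope ring_scope.

(** * Closures, linear subsets and finite nets *)

Lemma countableU (T : Type) (A B : set T) :
  countable A -> countable B -> countable (A `|` B).
Proof.
by move=> cA cB; rewrite -bigcup2E; apply: bigcup_countable => // -[|[|n]] _;
  rewrite ?countable0.
Qed.

Section prelim.
Context (R : realType) (X : normedModType R).
Implicit Types (A B V : set X) (x y z : X).

Lemma closure_normP A x :
  closure A x <-> forall eps : R, 0 < eps -> exists2 y, A y & `|x - y| < eps.
Proof.
split=> [clx eps eps0|clx B /nbhs_ballP[eps /= eps0 epsB]].
  have [y [Ay]] := clx _ (nbhsx_ballx x _ eps0).
  by rewrite -ball_normE; exists y.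
by have [y Ay xy] := clx eps eps0; exists y; split=> //; apply: epsB;
  rewrite -ball_normE.
Qed.

Definition linear_set V := V 0 /\ forall (a : R) u v, V u -> V v -> V (a *: u + v).

Lemma linear_setD V u v : linear_set V -> V u -> V v -> V (u + v).
Proof. by move=> [_ lV] Vu Vv; rewrite -[u]scale1r; apply: lV. Qed.

Lemma linear_setZ V (a : R) u : linear_set V -> V u -> V (a *: u).
Proof. by move=> [V0 lV] Vu; rewrite -[_ *: _]addr0; apply: lV. Qed.

Lemma linear_setN V u : linear_set V -> V u -> V (- u).
Proof. by move=> lV Vu; rewrite -scaleN1r; apply: linear_setZ. Qed.

Lemma linear_setB V u v : linear_set V -> V u -> V v -> V (u - v).
Proof. by move=> lV Vu Vv; apply: linear_setD => //; apply: linear_setN. Qed.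

Lemma linear_set_sum V (T : eqType) (s : seq T) (F : T -> X) : linear_set V ->
  (forall t, t \in s -> V (F t)) -> V (\sum_(t <- s) F t).
Proof.
move=> lV; elim: s => [|t s IH] VF; first by rewrite big_nil; case: lV.
rewrite big_cons; apply: linear_setD => //; first by apply: VF; rewrite mem_head.
by apply: IH => t' t's; apply: VF; rewrite inE t's orbT.
Qed.

Lemma linear_set_closure V : linear_set V -> linear_set (closure V).
Proof.
move=> [V0 lV]; split=> [|a u v /closure_normP clu /closure_normP clv].
  by apply: subset_closure.
apply/closure_normP => eps eps0.
have a0 : 0 < `|a| + 1 by rewrite ltr_wpDl.
have [|u' Vu' uu'] := clu (eps / 2 / (`|a| + 1)); first by rewrite !divr_gt0.
have [|v' Vv' vv'] := clv (eps / 2); first by rewrite divr_gt0.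
exists (a *: u' + v'); first exact: lV.
rewrite opprD addrACA -scalerBr (le_lt_trans (ler_normD _ _))// [eps]splitr.
rewrite ler_ltD// normrZ (@le_trans _ _ ((`|a| + 1) * `|u - u'|))//.
  by rewrite ler_wpM2r// lerDl.
by rewrite -ler_pdivlMl// mulrC ltW.
Qed.

Definition separable_set A := exists2 D : set X, countable D & A `<=` closure D.

(** Total boundedness of the bounded parts: the only consequence of finite
    dimension that the argument needs. *)
Definition finite_nets A := forall M eps : R, 0 < eps ->
  exists2 s : seq X, (forall y, y \in s -> A y) &
    forall x, A x -> `|x| <= M -> exists2 y, y \in s & `|x - y| < eps.

Lemma finite_nets_dense A : finite_nets A ->
  exists D, [/\ countable D, D `<=` A & A `<=` closure D].
Proof.
move=> netA.
have /choice[s sP] : forall n : nat, exists s : seq X, (forall y, y \in s -> A y) /\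
    forall x, A x -> `|x| <= n%:R -> exists2 y, y \in s & `|x - y| < n.+1%:R^-1.
  move=> n; have n0 : 0 < n.+1%:R^-1 :> R by rewrite invr_gt0.
  by have [s sA sn] := netA n%:R _ n0; exists s.
exists (\bigcup_n [set` s n]); split.
- by apply: bigcup_countable => // n _; apply: finite_set_countable; exact: finite_seq.
- by move=> y [n _ /=]; have [+ _] := sP n; apply.
move=> x Ax; apply/closure_normP => eps eps0.
near \oo => n; have [_ /(_ x Ax)[]] := sP n.
- near: n; exact: nbhs_infty_ger.
- move=> y yn xy; exists y; first by exists n.
  rewrite (lt_trans xy)//; near: n; exact: (near_infty_natSinv_lt (PosNum eps0)).
Unshelve. all: by end_near. Qed.

Lemma finite_nets_separable A : finite_nets A -> separable_set A.
Proof. by move=> /finite_nets_dense[D [cD _ AD]]; exists D. Qed.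

Definition span_of n (v : 'I_n -> X) : set X :=
  [set x | exists c : 'I_n -> R, x = \sum_(i < n) c i *: v i].

Lemma span_of_linear n (v : 'I_n -> X) : linear_set (span_of v).
Proof.
split=> [|a _ _ [c ->] [c' ->]].
  by exists (fun=> 0); rewrite big1// => i _; rewrite scale0r.
exists (fun i => a * c i + c' i); rewrite scaler_sumr -big_split /=.
by apply: eq_bigr => i _; rewrite scalerDl scalerA.
Qed.

Lemma interval_net (M eps : R) : 0 < eps ->
  exists s : seq R, forall t, `|t| <= M -> exists2 r, r \in s & `|t - r| < eps.
Proof.
move=> eps0; pose N := (Num.bound ((`|M| + 1) / eps)).+1.
have NM : (`|M| + 1) / eps < N%:R.
  rewrite (lt_trans (archi_boundP _))// ?ltr_nat//.
  by rewrite divr_ge0// ?addr_ge0// ltW.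
exists [seq (k%:R - N%:R) * eps | k <- iota 0 (N + N).+1] => t tM.
have tN : `|t| < N%:R * eps.
  rewrite -ltr_pdivrMr// (le_lt_trans _ NM)// ler_pM2r ?invr_gt0//.
  by rewrite (le_trans tM)// (le_trans (ler_norm _))// lerDl.
have p0 : 0 <= t / eps + N%:R.
  rewrite -(pmulr_lge0 _ eps0) mulrDl divfK ?gt_eqF//.
  by move: tN; rewrite ltr_norml => /andP[] ? ?; lra.
pose k := Num.truncn (t / eps + N%:R).
have /andP[k1 k2] : k%:R <= t / eps + N%:R < k.+1%:R by exact: truncn_itv.
exists ((k%:R - N%:R) * eps).
  apply/mapP; exists k => //; rewrite mem_iota /= add0n ltnS.
  rewrite -(ler_nat R) (le_trans k1)// natrD lerD2r.
  by rewrite ler_pdivrMr// (le_trans (ler_norm _))// ltW.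
have -> : t - (k%:R - N%:R) * eps = (t / eps + N%:R - k%:R) * eps.
  by field; rewrite gt_eqF.
rewrite -natr1 in k2; rewrite normrM (gtr0_norm eps0) gtr_pMl// ger0_norm; lra.
Qed.

(** Induction on the number of generators.  If the new vector v0 is adherent to
    the span V' of the others, a net of V' already serves.  Otherwise v0 is at
    positive distance from V', so the coefficient of v0 is bounded on bounded
    sets and a net of V' can be combined with a net of an interval. *)
Lemma span_of_finite_nets n (v : 'I_n -> X) : finite_nets (span_of v).
Proof.
elim: n v => [|n IH] v M eps eps0.
  exists [:: 0]; first by move=> y; rewrite inE => /eqP->; case: (span_of_linear v).
  by move=> x [c ->] _; exists 0; rewrite ?mem_head// big_ord0 subrr normr0.
pose v0 := v ord0; pose v' i := v (lift ord0 i).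
have VE u (t : R) : span_of v' u -> span_of v (t *: v0 + u).
  move=> [c ->]; exists (fun i => if unlift ord0 i is Some j then c j else t).
  rewrite big_ord_recl unlift_none; congr (_ + _).
  by apply: eq_bigr => i _; rewrite liftK.
have EV x : span_of v x -> exists t u, span_of v' u /\ x = t *: v0 + u.
  move=> [c ->]; exists (c ord0), (\sum_(i < n) c (lift ord0 i) *: v' i).
  by split; [exists (fun i => c (lift ord0 i))|rewrite big_ord_recl].
have [cl|ncl] := pselect (closure (span_of v') v0).
  have e2 : 0 < eps / 2 by rewrite divr_gt0.
  have [s sV sn] := IH v' (M + eps / 2) _ e2.
  exists s => [y /sV Vy|x /EV[t [u [Vu ->]]] xM].
    by rewrite -[y]add0r -[0](scale0r v0); apply: VE.
  have := linear_set_closure (span_of_linear v').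
  move=> [_ /(_ t v0 u cl (subset_closure Vu))] /closure_normP/(_ _ e2)[w Vw xw].
  have [|y ys wy] := sn w Vw.
    by rewrite -[w](subKr (t *: v0 + u)) (le_trans (ler_normB _ _))// lerD// ltW.
  by exists y; rewrite // [eps]splitr (le_lt_trans (ler_distD w _ _))// ltrD.
have [dlt [dlt0 dltP]] : exists dlt : R, 0 < dlt /\
    forall u, span_of v' u -> dlt <= `|v0 - u|.
  apply: contrapT => nd; apply: ncl; apply/closure_normP => e e0.
  apply: contrapT => ne; apply: nd; exists e; split=> // u Vu.
  by rewrite leNgt; apply/negP => ue; apply: ne; exists u.
have coefb t u : span_of v' u -> `|t| * dlt <= `|t *: v0 + u|.
  move=> Vu; have [->|t0] := eqVneq t 0; first by rewrite normr0 mul0r.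
  have -> : t *: v0 + u = t *: (v0 - (- (t^-1 *: u))).
    by rewrite opprK scalerDr scalerA divff// scale1r.
  rewrite normrZ ler_wpM2l//; apply: dltP.
  by apply: linear_setN; [|apply: linear_setZ => //]; exact: span_of_linear.
have b0 : 0 < `|v0| + 1 by rewrite ltr_wpDl.
have e2 : 0 < eps / 2 by rewrite divr_gt0.
have e2b : 0 < eps / 2 / (`|v0| + 1) by rewrite divr_gt0.
have [s1 s1n] := interval_net (M / dlt) e2b.
have [s2 s2V s2n] := IH v' (M + M / dlt * `|v0|) _ e2.
exists [seq r *: v0 + w | r <- s1, w <- s2].
  by move=> _ /allpairsP[[r w] /= [_ /s2V Vw ->]]; apply: VE.
move=> _ /EV[t [u [Vu ->]]] xM.
have tM : `|t| <= M / dlt by rewrite ler_pdivlMr// (le_trans (coefb _ _ Vu)).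
have [r rs tr] := s1n t tM.
have [|w ws uw] := s2n u Vu.
  have -> : u = (t *: v0 + u) - t *: v0 by rewrite addrAC subrr add0r.
  by rewrite (le_trans (ler_normB _ _))// lerD// normrZ ler_wpM2r.
exists (r *: v0 + w); first by apply/allpairsP; exists (r, w).
rewrite opprD addrACA -scalerBl (le_lt_trans (ler_normD _ _))// [eps]splitr.
rewrite ler_ltD// normrZ (@le_trans _ _ (`|t - r| * (`|v0| + 1)))//.
  by rewrite ler_wpM2l// lerDl.
by rewrite -ler_pdivlMr// ltW.
Qed.

End prelim.

(** * Chains of finite-dimensional pushouts inside their limit *)

(** The whole chain is encoded by subsets of its limit X.  [glue a] and
    [block a] are the images of the spaces E_a and F_a of the step at a; at an
    index without successor there is no step, and both can be taken to be {0}.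
    Of the pushout norm only [amalgam_norm] is kept: it says that the infimum
    defining the quotient norm is at most the norm in X, the converse being the
    triangle inequality. *)
Record fd_chain (R : realType) (X : normedModType R) (d : Order.disp_t)
    (I : orderType d) := FdChain {
  root : I;
  stage : I -> set X;
  glue : I -> set X;
  block : I -> set X;
  chain_wo : well_ordered I;
  root_least : is_least root;
  root_separable : separable_set (stage root);
  stage_linear : forall a, linear_set (stage a);
  block_linear : forall a, linear_set (block a);
  glue_nets : forall a, finite_nets (glue a);
  block_nets : forall a, finite_nets (block a);
  glue_stage : forall a, glue a `<=` stage a;
  stage_mono : forall a b, (a <= b)%O -> stage a `<=` stage b;
  block_stage : forall a b, is_succ a b -> block a `<=` stage b;
  stage_succ : forall a b x, is_succ a b -> stage b x ->
    exists u f, [/\ stage a u, block a f & x = u + f];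
  stage_limit : forall l, is_limit l ->
    stage l `<=` closure (\bigcup_(a in [set a | (a < l)%O]) stage a);
  stage_cover : forall x, closure (\bigcup_a stage a) x;
  amalgam_norm : forall a u f (eps : R), stage a u -> block a f -> 0 < eps ->
    exists2 e, glue a e & `|u + e| + `|f - e| <= `|u + f| + eps
}.

Section chain.
Context (R : realType) (X : normedModType R) (d : Order.disp_t) (I : orderType d).
Context (C : fd_chain X I).
Implicit Types (a b c : I) (S : set I) (x y z u f w : X) (eps : R).

Lemma chain_ind (P : I -> Prop) :
  (forall a, (forall b, (b < a)%O -> P b) -> P a) -> forall a, P a.
Proof.
move=> IH a; apply: contrapT => Pa.
have [m [Pm mP]] := @chain_wo _ _ _ _ C [set b | ~ P b] (ex_intro _ a Pa).
apply: Pm; apply: IH => b bm; apply: contrapT => /mP.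
by rewrite leNgt bm.
Qed.

Lemma chain_case a : [\/ is_least a, exists c, is_succ c a | is_limit a].
Proof.
have [|nl] := pselect (is_least a); first by constructor 1.
have [|ns] := pselect (exists c, is_succ c a); first by constructor 2.
by constructor 3; split=> // c ca; apply: ns; exists c.
Qed.

Lemma succ_exists a b : (a < b)%O -> exists c, is_succ a c.
Proof.
move=> ab.
have [c [ac cP]] := @chain_wo _ _ _ _ C [set c | (a < c)%O] (ex_intro _ b ab).
by exists c; split.
Qed.

Lemma lt_succ a b c : is_succ a b -> (c < b)%O = (c <= a)%O.
Proof.
move=> [ab abP]; apply/idP/idP => [cb|ca]; last exact: le_lt_trans ab.
by rewrite leNgt; apply/negP => /abP; rewrite leNgt cb.
Qed.

Lemma limit_lt l a : is_limit l -> (a < l)%O -> exists2 b, (a < b)%O & (b < l)%O.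
Proof.
move=> [_ limP] al; have [b [ab bP]] := succ_exists al.
exists b => //; rewrite lt_neqAle bP// andbT; apply/eqP => bl.
by apply: (limP a); rewrite -bl; split.
Qed.

Lemma stage_root a : stage C (root C) `<=` stage C a.
Proof. by apply: stage_mono; exact: root_least. Qed.

(** Blocks may be added in any order and repeatedly, which makes this set a
    subspace without any combinatorics on indices. *)
Inductive generated S : set X :=
| generated_root v : stage C (root C) v -> generated S v
| generated_block u c f : generated S u -> S c -> block C c f -> generated S (u + f).

Lemma generated_mono S S' : S `<=` S' -> generated S `<=` generated S'.
Proof.
move=> SS' x; elim=> [v|u c f _ IH Sc fc]; first exact: generated_root.
by apply: generated_block fc => //; apply: SS'.
Qed.

Lemma generated_linear S : linear_set (generated S).
Proof.
have gD x y : generated S x -> generated S y -> generated S (x + y).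
  move=> gx; elim=> [v v0|u c f _ IH Sc fc]; last first.
    by rewrite addrA; apply: generated_block fc.
  elim: gx => [v' v'0|u c f _ IH Sc fc].
    by apply: generated_root; apply: linear_setD => //; exact: stage_linear.
  by rewrite addrAC; apply: generated_block fc.
split; first by apply: generated_root; case: (stage_linear C (root C)).
move=> a u v gu gv; apply: gD gv; elim: gu => [w w0|w c f _ IH Sc fc].
  by apply: generated_root; apply: linear_setZ => //; exact: stage_linear.
rewrite scalerDr; apply: generated_block Sc _ => //.
by apply: linear_setZ => //; exact: block_linear.
Qed.

Definition hull S : set X := closure (generated S).

Lemma hull_linear S : linear_set (hull S).
Proof. exact: linear_set_closure (generated_linear S). Qed.

Lemma hull_mono S S' : S `<=` S' -> hull S `<=` hull S'.
Proof. by move=> /generated_mono; exact: closureS. Qed.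

Lemma hull_closure S x : closure (hull S) x -> hull S x.
Proof. by move=> clx; apply/closed_closure. Qed.

Lemma root_hull S : stage C (root C) `<=` hull S.
Proof. by move=> v v0; apply/subset_closure/generated_root. Qed.

Lemma block_hull S c : S c -> block C c `<=` hull S.
Proof.
move=> Sc f fc; apply: subset_closure; rewrite -[f]add0r.
by apply: generated_block fc => //; case: (generated_linear S).
Qed.

Definition below S b : set I := S `&` [set c | (c < b)%O].

Lemma below_sub S b : below S b `<=` S. Proof. exact: subIsetl. Qed.

Lemma below_mono S a b : (a <= b)%O -> below S a `<=` below S b.
Proof. by move=> ab c [Sc ca]; split=> //; apply: lt_le_trans ab. Qed.

Lemma below_stage S b : generated (below S b) `<=` stage C b.
Proof.
move=> x; elim=> [v|u c f _ IH [_ cb] fc]; first exact: stage_root.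
apply: linear_setD => //; first exact: stage_linear.
have [c' cc'] := succ_exists cb.
by apply: (stage_mono (a := c')); [case: cc' => _; apply|apply: block_stage fc].
Qed.

(** The blocks at c itself can be collected into one, which is where the step
    from c to its successor is isolated. *)
Lemma below_succ S c b x : is_succ c b -> generated (below S b) x ->
  exists u f, [/\ generated (below S c) u, block C c f & x = u + f] /\ (~ S c -> f = 0).
Proof.
move=> cb; have bl := block_linear C c.
elim=> [v v0|u c' f _ [u0 [f0 [[gu fb ->] f0S]]] [Sc' c'b] fc'].
  by exists v, 0; rewrite addr0; split=> //; split=> //;
    [exact: generated_root|case: bl].
have := c'b; rewrite /= (lt_succ _ cb) le_eqVlt => /orP[/eqP c'c|c'c]; last first.
  exists (u0 + f), f0; rewrite addrAC; split=> //; split=> //.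
  by apply: generated_block fc'.
rewrite c'c in fc' Sc'; exists u0, (f0 + f); rewrite addrA; split=> //.
by split=> //; apply: linear_setD.
Qed.

Lemma below_limit S l x : is_limit l -> generated (below S l) x ->
  exists2 a, (a < l)%O & generated (below S a) x.
Proof.
move=> liml; elim=> [v v0|u c f _ [a al gu] [Sc cl] fc].
  exists (root C); last exact: generated_root.
  by rewrite ltNge; apply/negP => lr; case: liml => + _; apply => b;
    apply: le_trans lr (root_least C b).
have [c' cc' c'l] := limit_lt liml cl.
exists (Order.max a c'); first by rewrite gt_max al.
apply: generated_block fc.
  by apply: generated_mono gu; apply: below_mono; rewrite le_max lexx.
by split=> //=; rewrite lt_max cc' orbT.
Qed.

(** Along a coherent S the chain can be rerun from the root with the steps of S
    only, because each of them glues along a space that the previous ones have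
    already produced.  A step must also have a successor, since its block is
    contained only in the next stage. *)
Definition coherent S : Prop :=
  forall c, S c -> (exists b, (c < b)%O) /\ glue C c `<=` hull (below S c).

(** A sum of blocks has finitely many indices, hence is built before some
    stage. *)
Lemma coherent_below S x a : coherent S -> generated S x ->
  exists2 b, (a <= b)%O & generated (below S b) x.
Proof.
move=> cohS; elim=> [v v0|u c f _ [b ab gu] Sc fc].
  by exists a => //; exact: generated_root.
have [[c' cc'] _] := cohS c Sc.
exists (Order.max b c'); first by rewrite le_max ab.
apply: generated_block fc.
  by apply: generated_mono gu; apply: below_mono; rewrite le_max lexx.
by split=> //=; rewrite lt_max cc' orbT.
Qed.

Lemma coherent_bigcup (T : Type) (D : set T) (S : T -> set I) :
  (forall t, D t -> coherent (S t)) -> coherent (\bigcup_(t in D) S t).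
Proof.
move=> cohS c [t Dt Stc]; have [cb gh] := cohS t Dt c Stc; split=> //.
by apply: subset_trans gh _; apply: hull_mono => c' [Stc' c'c]; split=> //; exists t.
Qed.

(** A stage and the hull of a coherent set are independent over the part of the
    hull that precedes the stage: a path from x to z may be routed through that
    part.  Induction on the stage b of z, which descends from b to its
    predecessor c by routing the path through [glue c] first; coherence keeps
    the intermediate point in the hull. *)
Lemma stage_hull_indep S a x z eps : coherent S -> stage C a x -> hull S z ->
  0 < eps -> exists2 w, generated (below S a) w & `|x - w| + `|w - z| <= `|x - z| + eps.
Proof.
move=> cohS.
have main : forall b, (a <= b)%O -> forall x z eps, stage C a x ->
    generated (below S b) z -> 0 < eps ->
    exists2 w, generated (below S a) w & `|x - w| + `|w - z| <= `|x - z| + eps.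
  apply: chain_ind => b IH ab {}x {}z {}eps xa gz eps0.
  have [ba|] := leP b a.
    exists z; last by rewrite subrr normr0 addr0 lerDl ltW.
    by apply: generated_mono gz; exact: below_mono.
  move=> {}ab; case: (chain_case b) => [/(_ a)|[c cb]|limb]; first by rewrite leNgt ab.
    have [u [f [[gu fc zE] fS]]] := below_succ cb gz.
    have lcb : (c < b)%O by case: cb.
    have ac : (a <= c)%O by rewrite -(lt_succ _ cb).
    have [Sc|nSc] := pselect (S c); last first.
      rewrite zE fS// addr0.
      by apply: IH lcb _ _ _ _ _ _ _ => //.
    (* the path from x to z = u + f goes through u - e, with e in glue c *)
    have e3 : 0 < eps / 4%:R by rewrite divr_gt0.
    have xuc : stage C c (x - u).
      apply: linear_setB (stage_linear C c) _ _; first exact: (stage_mono ac).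
      exact: below_stage gu.
    have fc' : block C c (- f) by apply: linear_setN fc; exact: block_linear.
    have [e ge ee] := amalgam_norm xuc fc' e3.
    have [_ /(_ e ge) /closure_normP/(_ _ e3)[e' ge' ee']] := cohS c Sc.
    have gue' : generated (below S c) (u - e').
      exact: linear_setB (generated_linear _) gu ge'.
    have [w gw we] := IH c lcb ac x _ _ xa gue' e3.
    exists w => //; rewrite zE.
    have h1 : `|x - (u + f)| = `|x - u - f| by rewrite opprD addrA.
    have h2 : `|w - (u + f)| <= `|w - (u - e')| + `|- f - e| + `|e - e'|.
      have -> : w - (u + f) = (w - (u - e')) + (- f - e) + (e - e').
        rewrite -addrA subrKA opprB [e' - u]addrC opprD !addrA.
        by rewrite [w - u + e' - f]addrAC addrK.
      exact: le_trans (ler_normD _ _) (lerD (ler_normD _ _) _).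
    have h3 : `|x - (u - e')| <= `|x - u + e| + `|e - e'|.
      have -> : x - (u - e') = (x - u + e) - (e - e').
        by rewrite !opprD !opprK !addrA addrK.
      exact: ler_normB.
    rewrite h1; lra.
  have [c cb gc] := below_limit limb gz.
  have [ca|ac] := leP c a.
    exists z; last by rewrite subrr normr0 addr0 lerDl ltW.
    by apply: generated_mono gc; exact: below_mono.
  exact: IH cb (ltW ac) _ _ _ xa gc eps0.
move=> xa /closure_normP clz eps0.
have e3 : 0 < eps / 3%:R by rewrite divr_gt0.
have [z' gz' zz'] := clz _ e3.
have [b ab gz''] := coherent_below a cohS gz'.
have [w gw we] := main b ab _ _ _ xa gz'' e3.
exists w => //.
have h1 := ler_distD z' w z; have h2 := ler_distD z x z'.
by move: zz' h1; rewrite (distrC z' z); lra.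
Qed.

End chain.

(** * Routing paths through finite sets *)

Section support.
Context (R : realType) (X : normedModType R) (d : Order.disp_t) (I : orderType d).
Context (C : fd_chain X I).
Implicit Types (a b c : I) (S : set I) (x y z u f w e : X) (eps M : R).
Local Notation hull := (hull C).
Local Notation coherent := (coherent C).

(** A finite description, up to eps, of the distances from x to the bounded part
    of the hull: each is the minimum of |x - e| + |e - z| over the list. *)
Definition finitely_based S x : Prop := forall M eps, 0 < eps ->
  exists2 s : seq X, (forall e, e \in s -> hull S e) &
    forall z, hull S z -> `|z| <= M ->
      exists2 e, e \in s & `|x - e| + `|e - z| <= `|x - z| + eps.

Lemma finitely_based_hull S x : hull S x -> finitely_based S x.
Proof.
move=> hx M eps eps0; exists [:: x] => [e|z hz zM].
  by rewrite inE => /eqP ->.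
by exists x; rewrite ?mem_head// subrr normr0 add0r lerDl ltW.
Qed.

Lemma finitely_based_closure S x : closure (finitely_based S) x -> finitely_based S x.
Proof.
move=> /closure_normP clx M eps eps0.
have e3 : 0 < eps / 3%:R by rewrite divr_gt0.
have [y ybased xy] := clx _ e3.
have [s sh sP] := ybased M _ e3; exists s => // z hz zM.
have [e es ee] := sP z hz zM; exists e => //.
have h1 := ler_distD y x e; have h2 := ler_distD x y z.
by move: h2; rewrite (distrC y x); lra.
Qed.

Lemma finitely_basedD S x f :
  hull S f -> finitely_based S x -> finitely_based S (x + f).
Proof.
move=> hf bx M eps eps0; have [s sh sP] := bx (M + `|f|) eps eps0.
have lh := hull_linear C S.
exists [seq e + f | e <- s] => [_ /mapP[e es ->]|z hz zM].
  by apply: (linear_setD lh); [exact: sh|].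
have [||e es ee] := sP (z - f).
- exact: (linear_setB lh).
- by rewrite (le_trans (ler_normB _ _))// lerD.
exists (e + f); first exact: map_f.
by move: ee; rewrite !opprB !addrA opprD [x + f + _]addrACA subrr addr0.
Qed.

(** Induction on the stage of x.  At a step c in S the block of x lies in the
    hull, and translating by it reduces to the previous stage.  At a step c
    outside S, a path from x to the hull passes through the hull below c, by
    independence, and then through [glue c], by the pushout norm.  The points of
    [glue c] that matter are bounded, hence a finite net t of them suffices,
    and each point of this net has a finite base by induction. *)
Lemma stage_finitely_based S a x : coherent S -> stage C a x -> finitely_based S x.
Proof.
move=> cohS; elim/(chain_ind C): a x => a IH x xa.
case: (chain_case a) => [la|[c ca]|lima]; last first.
- apply: finitely_based_closure; move: (stage_limit lima xa); apply: closureS.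
  by move=> y [b ba yb]; apply: IH yb.
- have [u [f [uc fc ->]]] := stage_succ ca xa.
  have lca : (c < a)%O by case: ca.
  have [Sc|nSc] := pselect (S c).
    by apply: finitely_basedD; [exact: block_hull fc|exact: IH uc].
  rewrite {xa} in IH *; set x' := u + f => M eps eps0.
  have xa : stage C a x'.
    apply: linear_setD (stage_linear C a) _ _; last exact: block_stage fc.
    by apply: stage_mono uc; exact: ltW.
  have e5 : 0 < eps / 5%:R by rewrite divr_gt0.
  (* K bounds the points of glue c through which near-optimal paths pass *)
  pose K := `|f| + `|x'| + `|x'| + M + 2 * eps.
  have [t tg tn] := @glue_nets _ _ _ _ C c K _ e5.
  have /choice[s sP] : forall g, exists s : seq X, g \in t ->
      (forall e, e \in s -> hull S e) /\
      forall w, hull S w -> `|w| <= `|x'| + `|x'| + M + eps ->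
        exists2 e, e \in s & `|u + g - e| + `|e - w| <= `|u + g - w| + eps / 5%:R.
    move=> g; have [gt|] := boolP (g \in t); last by exists [::].
    have ugc : stage C c (u + g).
      by apply: linear_setD (stage_linear C c) uc _; apply: glue_stage; exact: tg.
    by have [s] := IH c lca _ ugc (`|x'| + `|x'| + M + eps) _ e5; exists s.
  exists (flatten [seq s g | g <- t]).
    by move=> e /flatten_mapP[g gt es]; have [+ _] := sP g gt; apply.
  move=> z hz zM.
  have [w gw we] := stage_hull_indep cohS xa hz e5.
  have gw' : generated C (below S c) w.
    have [u' [f' [[gu' _ ->]] /(_ nSc) ->]] := below_succ ca gw.
    by rewrite addr0.
  have hw : hull S w.
    by apply/subset_closure; apply: generated_mono gw'; exact: below_sub.
  have uwc : stage C c (u - w).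
    by apply: linear_setB (stage_linear C c) uc _; exact: below_stage gw'.
  have [g gg ge] := amalgam_norm uwc fc e5.
  have xz : `|x' - z| <= `|x'| + M by rewrite (le_trans (ler_normB _ _))// lerD2l.
  have xw0 : `|x' - w| <= `|x'| + M + eps / 5%:R.
    by rewrite -lerBlDr in we; move: we (normr_ge0 (w - z)); lra.
  have wn : `|w| <= `|x'| + `|x'| + M + eps.
    have -> : w = x' - (x' - w) by rewrite subKr.
    by have := ler_normB x' (x' - w); lra.
  have x'E : u - w + f = x' - w by rewrite addrAC.
  rewrite x'E in ge.
  have gK : `|g| <= K.
    have -> : g = f - (f - g) by rewrite subKr.
    have := ler_normB f (f - g); have := normr_ge0 (u - w + g).
    by have := normr_ge0 x'; rewrite /K; lra.
  have [g' g't gg'] := tn g gg gK.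
  have [_ /(_ w hw wn)[e es ee]] := sP g' g't.
  exists e; first by apply/flatten_mapP; exists g'.
  have h1 : `|x' - e| <= `|f - g| + `|g - g'| + `|u + g' - e|.
    have -> : x' - e = (f - g) + (g - g') + (u + g' - e).
      rewrite subrKA [RHS]addrC [u + g' - e]addrAC [RHS]addrA.
      by rewrite [u - e + g' + f]addrAC addrK /x' addrAC.
    exact: le_trans (ler_normD _ _) (lerD (ler_normD _ _) _).
  have h2 : `|u + g' - w| <= `|u - w + g| + `|g - g'|.
    have -> : u + g' - w = (u - w + g) - (g - g').
      by rewrite opprB addrA [u - w + g + g']addrAC addrK addrAC.
    exact: ler_normB.
  have h3 := ler_distD w e z; lra.
- apply: finitely_based_hull; apply: root_hull.
  by apply: stage_mono xa; exact: la.
Qed.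

Lemma coherent_finitely_based S x : coherent S -> finitely_based S x.
Proof.
move=> cohS; apply: finitely_based_closure.
move: (@stage_cover _ _ _ _ C x); apply: closureS.
by move=> y [a _ ya]; exact: stage_finitely_based ya.
Qed.

(** * Countable supports *)

Definition supported (B : set I) x : Prop :=
  exists S, [/\ countable S, coherent S, S `<=` B & hull S x].

Lemma supported_countable (B : set I) (D : set X) : countable D ->
  (forall y, D y -> supported B y) ->
  exists S, [/\ countable S, coherent S, S `<=` B & closure D `<=` hull S].
Proof.
move=> cD suppD.
have /choice[S SP] : forall y, exists S, D y ->
    [/\ countable S, coherent S, S `<=` B & hull S y].
  move=> y; have [Dy|nDy] := pselect (D y); last by exists set0.
  by have [S ?] := suppD y Dy; exists S.
exists (\bigcup_(y in D) S y); split.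
- by apply: bigcup_countable => // y /SP[].
- by apply: coherent_bigcup => y /SP[].
- by move=> c [y /SP[_ _ SB _]]; apply: SB.
move=> x clx; apply: hull_closure; move: clx; apply: closureS => y Dy.
have [_ _ _] := SP y Dy; apply: hull_mono; exact: bigcup_sup.
Qed.

Lemma supported_closure (B : set I) x : closure (supported B) x -> supported B x.
Proof.
move=> /closure_normP clx.
have /choice[y yP] : forall n : nat, exists y, supported B y /\ `|x - y| < n.+1%:R^-1.
  move=> n; have [|y ? ?] := clx n.+1%:R^-1; first by rewrite invr_gt0.
  by exists y.
have [||S [cS cohS SB clS]] := @supported_countable B (range y).
- exact: card_image_le.
- by move=> _ [n _ <-]; case: (yP n).
exists S; split=> //; apply: clS; apply/closure_normP => eps eps0.
near \oo => n; exists (y n); first by exists n.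
have [_ xy] := yP n; rewrite (lt_trans xy)//.
near: n; exact: (near_infty_natSinv_lt (PosNum eps0)).
Unshelve. all: by end_near. Qed.

(** Induction on the stage of x.  To use the step c one must also support its
    glue, for which a countable dense subset of the glue is enough.  The bound
    on the indices keeps this support below c, as coherence requires. *)
Lemma stage_supported a x : stage C a x -> supported [set c | (c < a)%O] x.
Proof.
elim/(chain_ind C): a x => a IH x xa.
case: (chain_case a) => [la|[c ca]|lima]; last first.
- apply: supported_closure; move: (stage_limit lima xa); apply: closureS.
  move=> y [b ba yb]; have [S [cS cohS Sb hy]] := IH b ba y yb.
  by exists S; split=> // c /Sb /= cb; exact: lt_trans ba.
- have [u [f [uc fc ->]]] := stage_succ ca xa.
  have lca : (c < a)%O by case: ca.
  have [D [cD Dg gD]] := finite_nets_dense (@glue_nets _ _ _ _ C c).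
  have [||S [cS cohS Sc clS]] :=
      @supported_countable [set b | (b < c)%O] (u |` D).
  + exact: countableU (countable1 _) _.
  + move=> y [->|/Dg/glue_stage yc]; exact: IH.
  exists (c |` S); split.
  + exact: countableU (countable1 _) _.
  + move=> b [->|Sb].
      split; first by exists a.
      move=> e /gD clDe; have : hull S e.
        by apply: clS; move: clDe; apply: closureS; exact: subsetUr.
      apply: hull_mono => b' Sb'; split; first by right.
      exact: Sc.
    have [bb gb] := cohS b Sb; split=> //.
    apply: subset_trans gb _; apply: hull_mono => b' [Sb' b'b].
    by split=> //; right.
  + by move=> b [->//|/Sc /= bc]; exact: lt_trans lca.
  apply: (linear_setD (hull_linear C _)); last by apply: block_hull fc; left.
  have : hull S u by apply: clS; apply: subset_closure; left.
  by apply: hull_mono; exact: subsetUr.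
- exists set0; split; [exact: countable0|by []|by []|].
  by apply: root_hull; apply: stage_mono xa; exact: la.
Qed.

Lemma all_supported x : supported setT x.
Proof.
apply: supported_closure; move: (@stage_cover _ _ _ _ C x); apply: closureS.
move=> y [a _ /stage_supported[S [? ? _ ?]]]; by exists S.
Qed.

Lemma hull_separable S : countable S -> separable_set (hull S).
Proof.
move=> cS; have [D0 cD0 D0P] := root_separable C.
have /choice[D DP] : forall c, exists D, countable D /\ block C c `<=` closure D.
  move=> c; have [D ? ?] := finite_nets_separable (@block_nets _ _ _ _ C c).
  by exists D.
(* G n approximates the sums of n blocks *)
pose G := fix G n := if n is m.+1 then
  \bigcup_(u in G m) \bigcup_(c in S) [set u + f | f in D c] else D0.
have cG n : countable (G n).
  elim: n => //= n IH; do 2 (apply: bigcup_countable => // ? _).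
  exact: sub_countable (card_image_le _ _) (DP _).1.
exists (\bigcup_n G n); first exact: bigcup_countable.
move=> x hx; apply/closed_closure; move: hx; apply: closureS => {}x.
elim=> [v /D0P|u c f _ IH Sc fc].
  by apply: closureS; apply: (bigcup_sup (i := 0%N)).
apply/closure_normP => eps eps0.
have e2 : 0 < eps / 2 by rewrite divr_gt0.
have /closure_normP/(_ _ e2)[u' [n _ Gu'] uu'] := IH.
have [_ /(_ f fc)/closure_normP/(_ _ e2)[f' Df' ff']] := DP c.
exists (u' + f').
  by exists n.+1 => //; exists u' => //; exists c => //; exists f'.
by rewrite opprD addrACA (le_lt_trans (ler_normD _ _))// [eps]splitr ltrD.
Qed.

End support.

(** * Reflection and spreading of sums *)

Section reflection.
Context (R : realType) (X : normedModType R) (d : Order.disp_t) (I : orderType d).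
Context (C : fd_chain X I).
Implicit Types (S : set I) (y z w : X).
Local Notation hull := (hull C).
Local Notation coherent := (coherent C).

Lemma generated_bigcup (S : nat -> set I) y :
  {homo S : m n / (m <= n)%N >-> m `<=` n} ->
  generated C (\bigcup_k S k) y -> exists k, generated C (S k) y.
Proof.
move=> Smono; elim=> [v v0|u c f _ [k gu] [m _ Smc] fc].
  by exists 0%N; exact: generated_root.
exists (maxn k m); apply: generated_block fc.
  by apply: generated_mono gu; apply: Smono; exact: leq_maxl.
by apply: Smono Smc; exact: leq_maxr.
Qed.

Lemma seq_hull_bigcup (S : nat -> set I) (s : seq X) (eps : R) : 0 < eps ->
  {homo S : m n / (m <= n)%N >-> m `<=` n} ->
  (forall e, e \in s -> hull (\bigcup_k S k) e) ->
  exists k, forall e, e \in s -> exists2 e', hull (S k) e' & `|e - e'| < eps.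
Proof.
move=> eps0 Smono; elim: s => [|e s IH] sh; first by exists 0%N.
have [|k kP] := IH; first by move=> e' e's; apply: sh; rewrite inE e's orbT.
have /closure_normP/(_ _ eps0)[e' ge' ee'] := sh e (mem_head e s).
have [m gm] := generated_bigcup Smono ge'.
exists (maxn k m) => x; rewrite inE => /orP[/eqP ->|/kP[x' hx' xx']].
  exists e' => //; apply: subset_closure; apply: generated_mono gm.
  by apply: Smono; exact: leq_maxr.
by exists x' => //; apply: hull_mono hx'; apply: Smono; exact: leq_maxl.
Qed.

Context (U : eqType) (B : set U) (x : U -> X) (dlt K : R).
Context (dlt0 : 0 < dlt) (uncB : ~ countable B).
Context (sepB : forall i j, B i -> B j -> i <> j -> 4 * dlt <= `|x i - x j|).
Context (bndB : forall i, B i -> `|x i| <= K).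

(** Otherwise every x i is within 2 dlt of a point of a fixed countable set, and
    by separation no point of this set serves two indices. *)
Lemma far_from_hull S : countable S ->
  exists2 i, B i & forall z, hull S z -> 2 * dlt <= `|x i - z|.
Proof.
move=> cS; apply: contrapT => nfar; apply: uncB.
have [D cD hD] := hull_separable C cS.
have /choice[y yP] : forall i, exists y, B i -> D y /\ `|x i - y| < 2 * dlt.
  move=> i; have [Bi|nBi] := pselect (B i); last by exists 0.
  have [z [hz xz]] : exists z, hull S z /\ `|x i - z| < 2 * dlt.
    apply: contrapT => nz; apply: nfar; exists i => // z hz.
    by rewrite leNgt; apply/negP => xz; apply: nz; exists z.
  have /closure_normP/(_ (2 * dlt - `|x i - z|))[|y Dy zy] := hD z hz.
    by rewrite subr_gt0.
  by exists y => _; split=> //; have := ler_distD z (x i) y; lra.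
have /countable_injP[g ginj] := cD.
apply/countable_injP; exists (g \o y) => i j /set_mem Bi /set_mem Bj /= gij.
have [Di xi] := yP i Bi; have [Dj xj] := yP j Bj.
have yij : y i = y j by apply: ginj; rewrite ?inE.
apply: contrapT => /(sepB Bi Bj); have := ler_distD (y i) (x i) (x j).
by rewrite {2}yij (distrC (y j)); lra.
Qed.

(** If no S had the property, each S would have an extension nxt S that defeats
    every member of the family.  Iterate, and choose i with x i far from the
    hull of the union.  The finite base of x i in this hull can be moved into
    the hull of one iterate S k, so that x i is not defeated by S k.+1. *)
Lemma reflecting_support S0 : countable S0 -> coherent S0 ->
  exists S, [/\ S0 `<=` S, countable S, coherent S &
    forall S', S `<=` S' -> countable S' -> coherent S' ->
      exists2 i, B i & forall z, hull S' z -> `|z| <= 2 * K ->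
        exists2 w, hull S w & dlt + `|z - w| <= `|x i - z| ].
Proof.
move=> cS0 cohS0; apply: contrapT => nS.
pose good S := [/\ S0 `<=` S, countable S & coherent S].
pose bad S S' := forall i, B i -> exists z, [/\ hull S' z, `|z| <= 2 * K &
  forall w, hull S w -> `|x i - z| < dlt + `|z - w| ].
have /choice[nxt nxtP] : forall S, exists S', good S ->
    [/\ S `<=` S', good S' & bad S S'].
  move=> S; have [[S0S cS cohS]|ngS] := pselect (good S); last by exists set0.
  apply: contrapT => nS'; apply: nS; exists S; split=> // S' SS' cS' cohS'.
  apply: contrapT => ni; apply: nS'; exists S' => _; split=> //.
    by split=> //; exact: subset_trans SS'.
  move=> i Bi; apply: contrapT => nz; apply: ni; exists i => // z hz zK.
  apply: contrapT => nw; apply: nz; exists z; split=> // w hw.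
  by rewrite ltNge; apply/negP => xz; apply: nw; exists w.
pose S k := iter k nxt S0.
have gS k : good (S k) by elim: k => [|k /nxtP[] //]; split.
have Smono : {homo S : m n / (m <= n)%N >-> m `<=` n}.
  apply: homo_leq => [A|A A' A'' |k]; [exact: subset_refl|exact: subset_trans|].
  by have [] := nxtP _ (gS k).
have cT : countable (\bigcup_k S k).
  by apply: bigcup_countable => // k _; case: (gS k).
have cohT : coherent (\bigcup_k S k).
  by apply: coherent_bigcup => k _; case: (gS k).
have [i Bi far] := far_from_hull cT.
have d4 : 0 < dlt / 4%:R by rewrite divr_gt0.
have [s sh sP] := coherent_finitely_based (x i) cohT (2 * K) d4.
have [k kP] := seq_hull_bigcup d4 Smono sh.
have [_ _ /(_ i Bi)[z [hz zK zw]]] := nxtP _ (gS k).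
have hTz : hull (\bigcup_k S k) z.
  by apply: hull_mono hz; apply: (bigcup_sup (i := k.+1)).
have [e es ee] := sP z hTz zK.
have [e' he' ee'] := kP e es.
have := zw e' he'; have := far e (sh e es); have := ler_distD e z e'.
by rewrite (distrC z e); lra.
Qed.

(** The next index i is chosen with respect to a support of the sum y of the
    previous terms.  The distance from x i to z = s - y then exceeds by dlt the
    distance from z to some w in the hull of S, which is the distance from y to
    s - w, and the induction hypothesis applies to s - w.  Only points z of norm
    at most 2 K occur, because the distances involved decrease along the
    induction. *)
Lemma spread_sums S0 n : countable S0 -> coherent S0 ->
  exists l : seq U, [/\ uniq l, (forall i, i \in l -> B i), size l = n &
    forall s, hull S0 s -> `|\sum_(i <- l) x i - s| <= K ->
      n%:R * dlt <= `|\sum_(i <- l) x i - s| ].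
Proof.
move=> cS0 cohS0; have [S [S0S cS cohS SP]] := reflecting_support cS0 cohS0.
suff [l [ul lB sl lP]] : exists l : seq U,
    [/\ uniq l, (forall i, i \in l -> B i), size l = n &
    forall s, hull S s -> `|\sum_(i <- l) x i - s| <= K ->
      n%:R * dlt <= `|\sum_(i <- l) x i - s| ].
  by exists l; split=> // s /(hull_mono S0S); exact: lP.
elim: n => [|n [l [ul lB sl lP]]].
  by exists [::]; split=> // s _ _; rewrite mul0r.
have [D [cD DS]] : exists S', [/\ countable S', coherent S' & S `<=` S' /\
    forall i, i \in l -> hull S' (x i)].
  have [||T [cT cohT _ clT]] :=
      @supported_countable _ _ _ _ C setT [set x i | i in [set` l]].
  - apply: sub_countable (card_image_le _ _) _.
    by apply: finite_set_countable; exact: finite_seq.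
  - by move=> y _; exact: all_supported.
  exists (S `|` T); split.
  - exact: countableU.
  - rewrite -bigcup2E; apply: coherent_bigcup => -[_|[_|k _]] //= c [].
  - split=> [|i il]; first exact: subsetUl.
    have : hull T (x i) by apply: clT; apply: subset_closure; exists i.
    by apply: hull_mono; exact: subsetUr.
move=> [SD xD]; have [i Bi iP] := SP D SD cD DS.
have hl := hull_linear C S; have hD := hull_linear C D.
have K0 : 0 <= K by rewrite (le_trans _ (bndB Bi)).
have il : i \notin l.
  apply/negP => il; have [|w hw] := iP (x i) (xD i il).
    by have := bndB Bi; lra.
  by rewrite subrr normr0 leNgt ltr_wpDr.
exists (i :: l); split=> /=.
- by rewrite il.
- by move=> j; rewrite inE => /orP[/eqP ->|/lB].
- by rewrite sl.
move=> s hs; rewrite big_cons; set y := \sum_(j <- l) x j => yK.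
have hy : hull D (s - y).
  apply: (linear_setB hD); first exact: hull_mono hs.
  exact: (linear_set_sum hD).
have xsy : x i + y - s = x i - (s - y) by rewrite opprB addrA.
have [|w hw ww] := iP _ hy.
  rewrite -[s - y](subKr (x i)) -xsy (le_trans (ler_normB _ _))//.
  by have := bndB Bi; lra.
have ysw : `|s - y - w| = `|y - (s - w)|.
  by rewrite distrC opprB addrC opprB addrA addrAC.
have := lP (s - w) (linear_setB hl hs hw).
rewrite -/y -ysw -natr1 mulrDl mul1r xsy => lP'.
rewrite xsy in yK; have /lP' : `|s - y - w| <= K.
  by move: dlt0; lra.
lra.
Qed.

End reflection.

(** * From the class to chains of subsets *)

Section chain_of_PO_fd.
Context (R : realType).

Lemma linear_range (V X : normedModType R) (h : V -> X) :
  linear h -> linear_set (range h).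
Proof.
move=> lh; split=> [|a _ _ [u _ <-] [v _ <-]]; last first.
  by exists (a *: u + v) => //; rewrite lh.
by exists 0 => //; have := lh (-1) 0 0; rewrite !scaleN1r !addNr.
Qed.

Lemma finite_dimensional_range_nets (V X : normedModType R) (h : V -> X) :
  finite_dimensional V -> linear h -> finite_nets (range h).
Proof.
move=> [n [v vP]] lh.
suff -> : range h = span_of (h \o v) by exact: span_of_finite_nets.
have hS (c : 'I_n -> R) : h (\sum_(i < n) c i *: v i) = \sum_(i < n) c i *: h (v i).
  have h0 : h 0 = 0 by have := lh (-1) 0 0; rewrite !scaleN1r !addNr.
  by elim/big_rec2 : _ => [|k y x _ <-]; rewrite ?h0 ?lh.
apply/seteqP; split=> [_ [x _ <-]|_ [c ->]].
  by have [c ->] := vP x; exists c; rewrite hS.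
by exists (\sum_(i < n) c i *: v i).
Qed.

(** A near-minimal representative of the class of (f, y) differs from it by
    (i z, - j z) for some z in E; the image of - z is the vector required by
    the norm condition. *)
Lemma fd_pushout_step_blocks (X X1 X2 : completeNormedModType R)
    (e1 : linear_isometry X1 X) (e2 : linear_isometry X2 X) :
  fd_pushout_step e1 e2 -> exists G B : set X,
  [/\ linear_set B, finite_nets G /\ finite_nets B,
      G `<=` range e1 /\ B `<=` range e2,
      forall x, range e2 x -> exists u f, [/\ range e1 u, B f & x = u + f] &
      forall u f (eps : R), range e1 u -> B f -> 0 < eps ->
        exists2 g, G g & `|u + g| + `|f - g| <= `|u + f| + eps].
Proof.
move=> [E [F [i [j [T [fdE fdF surT Te]]]]]].
pose phi (f : F) : X := e2 (T (pushout_inl i j f)).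
pose psi (z : E) : X := e1 (j z).
have lphi : linear phi.
  move=> a u v; rewrite /phi -!linearP /pushout_inl.
  congr (e2 (T (quotient_proj _ _))).
  by rewrite [RHS]surjective_pairing /= scaler0 addr0.
have lpsi : linear psi by move=> a u v; rewrite /psi !linearP.
have inl_le f : `|pushout_inl i j f| <= `|f|.
  by rewrite (le_trans (quotient_norm_le _ _))// l1_normE /= normr0 addr0.
have projE f y : e2 (T (quotient_proj (pushout_delta i j) (f, y))) = phi f + e1 y.
  rewrite -Te /phi -!linearD; congr (e2 (T (quotient_proj _ _))).
  by rewrite [RHS]surjective_pairing /= addr0 add0r.
exists (range psi), (range phi); split.
- exact: linear_range.
- by split; exact: finite_dimensional_range_nets.
- split=> [_ [z _ <-]|_ [f _ <-]]; first by exists (j z).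
  by exists (T (pushout_inl i j f)).
- move=> _ [x2 _ <-].
  have [q _ <-] : range T x2 by rewrite surT.
  have [[f y] <-] := quotient_projP q.
  by exists (e1 y), (phi f); rewrite projE addrC.
move=> _ _ eps [y _ <-] [f _ <-] eps0.
have [v vq vle] := quotient_norm_adherent
  (quotient_proj (pushout_delta i j) (f, y)) eps0.
move/quotient_proj_eq: vq => /set_mem[z _ zE].
have vE : v = pushout_relation i j z + (f, y) by rewrite zE subrK.
have psiE : psi z = phi (i z).
  rewrite /psi -Te /phi; congr (e2 (T _)); apply/esym/quotient_proj_eq/mem_set.
  by exists z => //; rewrite [RHS]surjective_pairing /= subr0 sub0r.
exists (- psi z); first by exists (- z); rewrite // /psi !linearN.
rewrite opprK.
have -> : e1 y - psi z = e1 (y - j z) by rewrite /psi linearB.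
have -> : phi f + psi z = phi (i z + f).
  by rewrite psiE addrC -[phi (i z)]scale1r -lphi scale1r.
rewrite [e1 y + _]addrC -projE !lisomP addrC.
apply: le_trans (ltW vle); rewrite l1_normE vE /= [- _ + y]addrC lerD2r.
exact: inl_le.
Qed.

Lemma PO_fd_chain (X : completeNormedModType R) : PO_fd X ->
  exists (d : Order.disp_t) (I : orderType d), inhabited (fd_chain X I).
Proof.
move=> [d [I [X_ [e [wo [mono [[r [rleast [D [cD denseD]]]] [lim [succ cover]]]]]]]]].
exists d, I.
have rlin a : linear_set (range (e a)) by apply: linear_range => k u v; rewrite linearP.
have lin0 : linear_set [set (0 : X)].
  by split=> [//|k _ _ -> ->]; rewrite scaler0 addr0.
have nets0 : finite_nets [set (0 : X)].
  move=> M eps eps0; exists [:: 0] => [y|x -> _]; first by rewrite inE => /eqP ->.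
  by exists 0; rewrite ?mem_head// subrr normr0.
have /choice[GB GBP] : forall a, exists GB : set X * set X,
    [/\ linear_set GB.2, finite_nets GB.1 /\ finite_nets GB.2,
      GB.1 `<=` range (e a),
      forall b, is_succ a b -> GB.2 `<=` range (e b) /\
        forall x, range (e b) x ->
          exists u f, [/\ range (e a) u, GB.2 f & x = u + f] &
      forall u f (eps : R), range (e a) u -> GB.2 f -> 0 < eps ->
        exists2 g, GB.1 g & `|u + g| + `|f - g| <= `|u + f| + eps].
  move=> a; have [[b ab]|nsucc] := pselect (exists b, is_succ a b); last first.
    exists ([set 0], [set 0]); split=> //=.
    - by move=> _ ->; exists 0; rewrite ?linear0.
    - by move=> b ab; case: nsucc; exists b.
    by move=> u f eps _ -> eps0; exists 0; rewrite // subr0 normr0 !addr0 lerDl ltW.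
  have [G [B [linB nGB [Ga Bb] surj push]]] := fd_pushout_step_blocks (succ a b ab).
  exists (G, B); split=> // b' ab'.
  suff -> : b' = b by [].
  by apply/le_anti; rewrite ab.2 ?ab'.1// ab'.2// ab.1.
constructor; apply: (@FdChain R X d I r (fun a => range (e a)) (fun a => (GB a).1)
  (fun a => (GB a).2)) => //.
- exists (e r @` D); first exact: sub_countable (card_image_le _ _) cD.
  move=> _ [x _ <-]; apply/closure_normP => eps eps0.
  have [y [xy Dy]] : (ball x eps `&` D) !=set0.
    by apply: denseD; [exists x; exact: ballxx|exact: ball_open].
  exists (e r y); first by exists y.
  by rewrite -linearB lisomP; move: xy; rewrite -ball_normE.
- by move=> a; case: (GBP a).
- by move=> a; case: (GBP a) => _ [].
- by move=> a; case: (GBP a) => _ [].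
- by move=> a; case: (GBP a).
- by move=> a b ab; case: (GBP a) => _ _ _ /(_ b ab)[].
- by move=> a b x ab; case: (GBP a) => _ _ _ /(_ b ab)[_ + _]; apply.
- by move=> l /lim ->.
- by move=> x; rewrite cover.
- by move=> a; case: (GBP a).
Qed.

End chain_of_PO_fd.

(** * Functions on the compact space of an almost disjoint family *)

Section psi_functions.
Context (A : set (set nat)).
Implicit Types (a b : A) (n : nat).

Definition leaf a : set (psi_space A) := [set inr a] `|` (inl @` set_val a).

Lemma psi_base_open (U : set (psi_space A)) : psi_base U -> open U.
Proof. by move=> bU; exists [set U]; [move=> _ ->|rewrite bigcup_set1]. Qed.

Lemma psi_openP (U : set (psi_space A)) p : open U -> U p ->
  exists V, [/\ psi_base V, V p & V `<=` U].
Proof.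
move=> [D Dbase <-] [V DV Vp]; exists V; split=> //; first exact: Dbase.
exact: bigcup_sup.
Qed.

Lemma psi_base_inr a (V : set (psi_space A)) : psi_base V -> V (inr a) ->
  exists F : set nat, finite_set F /\ V = [set inr a] `|` (inl @` (set_val a `\` F)).
Proof.
case=> [[n ->] //|[b [F [fF ->]]] [[ba]|[? ? //]]].
by exists F; rewrite ba.
Qed.

Lemma singleton_open n : open ([set inl n] : set (psi_space A)).
Proof. by apply: psi_base_open; left; exists n. Qed.

Lemma leaf_open a : open (leaf a).
Proof.
apply: psi_base_open; right; exists a, set0; split; first exact: finite_set0.
by rewrite setD0.
Qed.

(** A filter on the leaf that does not cluster at its non-isolated point
    contains a finite subset of the leaf. *)
Lemma leaf_compact a : compact (leaf a).
Proof.
move=> F PF Fa.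
have [cl|ncl] := pselect (cluster F (inr a)); first by exists (inr a); split=> //; left.
have [G [FG [U [nU GU]]]] : exists G, F G /\ exists U, nbhs (inr a : psi_space A) U /\
    G `&` U = set0.
  apply: contrapT => nG; apply: ncl => G U FG nU.
  by apply/set0P/eqP => GU; apply: nG; exists G; split=> //; exists U.
move: nU; rewrite nbhsE => -[V [oV Va] VU].
have [W [bW Wa WV]] := psi_openP oV Va.
have [E [fE WE]] := psi_base_inr bW Wa.
have cE : compact (inl @` (set_val a `&` E) : set (psi_space A)).
  by apply/finite_compact/finite_image/finite_setIr.
have [] := cE F PF.
  apply: filterS (filterI FG Fa) => p [Gp [pa|[n an np]]].
    have : (G `&` U) p by split=> //; apply: VU; rewrite pa.
    by rewrite GU.
  exists n => //; split=> //; apply: contrapT => nE.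
  have : (G `&` U) p by split=> //; apply/VU/WV; rewrite WE; right; exists n.
  by rewrite GU.
by move=> p [[n [an En] np] clp]; exists p; split=> //; right; exists n.
Qed.

Lemma singleton_compact n : compact ([set inl n] : set (psi_space A)).
Proof. exact/finite_compact/finite_set1. Qed.

Lemma singleton_closed n : closed ([set inl n] : set (psi_space A)).
Proof.
rewrite -[X in closed X]setCK; apply: open_closedC; rewrite openE => p np.
case: p np => [m mn|a _].
  apply: (filterS (P := [set inl m])) => [_ -> //|].
  by apply: open_nbhs_nbhs; split=> //; exact: singleton_open.
pose V : set (psi_space A) := [set inr a] `|` (inl @` (set_val a `\` [set n])).
apply: (filterS (P := V)) => [_ [-> //|[m [_ mn] <-] [nm]]|]; first exact: mn.
apply: open_nbhs_nbhs; split; last by left.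
by apply: psi_base_open; right; exists a, [set n]; split=> //; exact: finite_set1.
Qed.

Context (adA : almost_disjoint_family A).

Lemma almost_disjoint_leaf a b : a <> b -> finite_set (set_val a `&` set_val b).
Proof.
move=> ab; apply: adA.2; [exact: set_valP|exact: set_valP|].
by move=> /val_inj.
Qed.

Lemma leaf_closed a : closed (leaf a).
Proof.
rewrite -[X in closed X]setCK; apply: open_closedC; rewrite openE => p np.
case: p np => [m mn|b nb].
  apply: (filterS (P := [set inl m])) => [_ -> //|].
  by apply: open_nbhs_nbhs; split=> //; exact: singleton_open.
have ba : b <> a by move=> ba; apply: nb; left; rewrite ba.
pose V : set (psi_space A) := [set inr b] `|` (inl @` (set_val b `\` set_val a)).
apply: (filterS (P := V)).
  by move=> _ [-> //|[m [_ mna] <-]] [//|[k ak [km]]]; apply: mna; rewrite -km.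
apply: open_nbhs_nbhs; split; last by left.
apply: psi_base_open; right; exists b, (set_val b `&` set_val a); split.
  exact: almost_disjoint_leaf.
by rewrite /V setDIr setDv set0U.
Qed.

Context (R : realType).

Definition indicator (P : set (psi_space A)) (k : K_A A) : R^o :=
  if k is Some p then (p \in P)%:R else 0.

(** Compactness of P gives continuity at the point at infinity. *)
Lemma indicator_continuous (P : set (psi_space A)) :
  open P -> closed P -> compact P -> continuous (indicator P).
Proof.
move=> oP cP kP k.
suff lc : nbhs k [set k' | indicator P k' = indicator P k].
  by move=> V /nbhs_singleton Vk; apply: filterS lc => k' /= ->.
case: k => [p|].
  have [Pp|nPp] := pselect (P p).
    have := open_nbhs_nbhs (conj oP Pp) => /one_point_compactification_some_nbhs.
    by apply: filterS => _ [q Pq <-] /=; rewrite !mem_set.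
  have := open_nbhs_nbhs (conj (closed_openC cP) nPp).
  move=> /one_point_compactification_some_nbhs.
  by apply: filterS => _ [q Pq <-] /=; rewrite !memNset.
by exists P => // _ [[q Pq <-] /=|-> //]; rewrite memNset.
Qed.

Definition cfun_of (f : K_A A -> R^o) (cf : continuous f) : cfun (K_A A) R :=
  CFun (mem_set cf).

Definition leaf_fun a : cfun (K_A A) R :=
  cfun_of (indicator_continuous (leaf_open a) (@leaf_closed a) (@leaf_compact a)).

Definition singleton_fun n : cfun (K_A A) R :=
  cfun_of (indicator_continuous (singleton_open n) (@singleton_closed n)
    (@singleton_compact n)).

Lemma cfun_sumE (T : Type) (s : seq T) (F : T -> cfun (K_A A) R) k :
  (\sum_(t <- s) F t) k = \sum_(t <- s) F t k.
Proof. by elim/big_rec2 : _ => // t y1 y2 _ <-. Qed.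

Lemma leaf_fun_inl a n : leaf_fun a (Some (inl n)) = (n \in set_val a)%:R.
Proof.
congr (nat_of_bool _)%:R; apply/idP/idP => /set_mem h; apply/mem_set.
  by case: h => // -[m am [<-]].
by right; exists n.
Qed.

Lemma leaf_fun_inr a b : leaf_fun a (Some (inr b)) = (a == b)%:R.
Proof.
congr (nat_of_bool _)%:R; apply/idP/eqP => [/set_mem [[->]//|[? ? //]]|->].
by apply/mem_set; left.
Qed.

Lemma singleton_fun_inl m n : singleton_fun m (Some (inl n)) = (m == n)%:R.
Proof.
congr (nat_of_bool _)%:R; apply/idP/eqP => [/set_mem [->]//|->].
exact/mem_set.
Qed.

Lemma singleton_fun_inr m b : singleton_fun m (Some (inr b)) = 0.
Proof. by rewrite /= memNset. Qed.

Lemma leaf_fun_norm a : `|leaf_fun a| <= 1.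
Proof.
apply: sup_norm_le => // -[p|] /=; last by rewrite normr0.
by case: (_ \in _); rewrite ?normr0 ?normr1.
Qed.

Lemma leaf_fun_separated a b : a <> b -> 1 <= `|leaf_fun a - leaf_fun b|.
Proof.
move=> ab; set f := leaf_fun a - leaf_fun b.
suff : 1 <= `|f (Some (inr a))|.
  by move=> /le_trans; apply; exact: le_sup_norm.
have -> : f (Some (inr a)) = leaf_fun a (Some (inr a)) - leaf_fun b (Some (inr a)).
  by [].
by rewrite !leaf_fun_inr eqxx; case: eqP => [/esym//|_]; rewrite subr0 normr1.
Qed.

Lemma leaf_sum_overlap (l : seq A) : uniq l -> exists N, forall n, (N <= n)%N ->
  (\sum_(a <- l) (n \in set_val a)%:R : R) <= 1.
Proof.
elim: l => [_|a l IH /= /andP[al ul]]; first by exists 0%N => n _; rewrite big_nil.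
have [N NP] := IH ul.
have [M MP] : exists M, forall n, (M <= n)%N -> n \in set_val a ->
    forall b, b \in l -> n \notin set_val b.
  elim: l al {IH ul NP} => [_|b l IH]; first by exists 0%N.
  rewrite inE negb_or => /andP[/eqP ab /IH[M MP]].
  have [K KP] : exists K, forall n, (set_val a `&` set_val b) n -> (n < K)%N.
    have /finite_seqP[s ->] := almost_disjoint_leaf ab.
    by exists (\max_(i <- s) i).+1 => n ns; rewrite ltnS leq_bigmax_seq.
  exists (maxn M K) => n; rewrite geq_max => /andP[Mn Kn] na c.
  rewrite inE => /orP[/eqP ->|]; last exact: MP.
  apply/negP => nb; have := KP n (conj (set_mem na) (set_mem nb)).
  by rewrite ltnNge Kn.
exists (maxn N M) => n; rewrite geq_max => /andP[Nn Mn]; rewrite big_cons.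
have [na|na] := boolP (n \in set_val a); last by rewrite add0r; exact: NP.
rewrite big_seq big1 ?addr0// => b bl.
by rewrite (negbTE (MP n Mn na b bl)).
Qed.

(** Beyond some N the leaves do not overlap on integers, and they never share a
    non-isolated point, so it suffices to cancel the sum on the first N
    integers. *)
Lemma leaf_sum_approx (l : seq A) : uniq l -> exists c : seq (R * nat),
  `|\sum_(a <- l) leaf_fun a - \sum_(t <- c) t.1 *: singleton_fun t.2| <= 1.
Proof.
move=> ul; have [N NP] := leaf_sum_overlap ul.
pose f := \sum_(a <- l) leaf_fun a.
exists [seq (f (Some (inl n)), n) | n <- iota 0 N]; rewrite big_map /=.
rewrite -/f; set h := \sum_(n <- _) _.
apply: sup_norm_le => // k; rewrite (_ : (f - h) k = f k - h k)//.
have f01 p : 0 <= f p.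
  by rewrite cfun_sumE sumr_ge0// => a _; case: p => [p|] //=.
have hk : h k = \sum_(n <- iota 0 N) f (Some (inl n)) * singleton_fun n k.
  by rewrite cfun_sumE.
case: k hk => [[n|b]|] hk.
- have [nN|Nn] := ltnP n N.
    have nI : n \in iota 0 N by rewrite mem_iota.
    rewrite hk (bigD1_seq n nI (iota_uniq 0 N)) big1 => [|m /negbTE mn].
      by rewrite singleton_fun_inl eqxx mulr1 /= addr0 subrr normr0.
    by rewrite singleton_fun_inl mn mulr0.
  rewrite hk big_seq big1 ?subr0 => [|m].
    rewrite ger0_norm// cfun_sumE; under eq_bigr do rewrite leaf_fun_inl.
    exact: NP.
  rewrite mem_iota add0n => /andP[_ mN]; rewrite singleton_fun_inl.
  by rewrite (ltn_eqF (leq_trans mN Nn)) mulr0.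
- rewrite hk big1 ?subr0 => [|m _]; last by rewrite singleton_fun_inr mulr0.
  rewrite ger0_norm// cfun_sumE; under eq_bigr do rewrite leaf_fun_inr.
  have [bl|bl] := boolP (b \in l).
    rewrite (bigD1_seq b)//= eqxx big1 ?addr0// => a ab.
    by rewrite (negbTE ab).
  rewrite big_seq big1// => a al; case: eqP => // ab.
  by rewrite -ab al in bl.
- rewrite hk big1 ?subr0 => [|m _]; last by rewrite mulr0.
  by rewrite cfun_sumE big1 ?normr0.
Qed.

End psi_functions.

(** * Sums of leaf functions cannot spread *)

Theorem corollary6p5 (R : realType) (X : completeNormedModType R)
    (A : set (set nat)) (hX : PO_fd X) (hA : almost_disjoint_family A)
    (hcard : card_eq_aleph1 A) :
  ~ contains_isomorphic_copy X (cfun (K_A A) R).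
Proof.
have [d [I [C]]] := PO_fd_chain hX; move=> [T [c [M [c0 TP]]]].
pose K := `|M|.
have TK y : `|y| <= 1 -> `|T y| <= K.
  move=> y1; have /andP[_ /le_trans] := TP y; apply.
  by rewrite (le_trans (ler_norm _))// normrM normr_id ler_piMr.
pose x (a : A) : X := T (leaf_fun hA R a).
have [||S [cS cohS _ clS]] := @supported_countable _ _ _ _ C setT
    (range (fun n => T (singleton_fun A R n))).
- by apply: sub_countable (card_image_le _ _) _; exact: countableP.
- by move=> y _; exact: all_supported.
(* the images of the leaf functions are c-separated, that is 4 (c / 4) *)
have c4 : 0 < c / 4%:R by rewrite divr_gt0.
have uncA : ~ countable [set: A].
  by rewrite (eq_countable (card_setT A)); exact: hcard.1.
have sepx a b : [set: A] a -> [set: A] b -> a <> b -> 4%:R * (c / 4%:R) <= `|x a - x b|.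
  move=> _ _ ab; rewrite mulrC divfK// -linearB.
  have /andP[+ _] := TP (leaf_fun hA R a - leaf_fun hA R b); apply: le_trans.
  by rewrite ler_peMr ?(ltW c0)//; exact: leaf_fun_separated.
have bndx a : [set: A] a -> `|x a| <= K by move=> _; apply/TK/leaf_fun_norm.
pose n := (Num.bound (K / (c / 4%:R))).+1.
have [l [ul _ _ lP]] := spread_sums c4 uncA sepx bndx n cS cohS.
have [s sP] := leaf_sum_approx hA R ul.
pose h := \sum_(t <- s) t.1 *: singleton_fun A R t.2.
have hull_Th : hull C S (T h).
  rewrite linear_sum; apply: (linear_set_sum (hull_linear C S)) => t _.
  rewrite linearZ; apply: (linear_setZ _ (hull_linear C S)).
  by apply: clS; apply: subset_closure; exists t.2.
have Tsum : \sum_(a <- l) x a - T h = T (\sum_(a <- l) leaf_fun hA R a - h).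
  by rewrite linearB [T (\sum_(a <- l) _)]linear_sum.
have := lP (T h) hull_Th; rewrite Tsum => /(_ (TK _ sP)).
move=> /le_trans/(_ (TK _ sP)); apply/negP; rewrite -ltNge -ltr_pdivrMr//.
apply: lt_trans (_ : (Num.bound (K / (c / 4%:R)))%:R < _); last by rewrite ltr_nat.
by apply: archi_boundP; rewrite divr_ge0 ?normr_ge0// ltW.
Qed.
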